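(* Let $(X,T)$ be a topological dynamical system. If $x,y\in X$ are uniformly generic points, then $BF(x,y)$ exists, i.e. $\overline{BF}(x,y)=\underline{BF}(x,y)$.
   Context: A topological dynamical system $(X,T)$ is a compact metric space $X$ with metric $d$ together with a continuous map $T:X\to X$. $\mathbb{N}$ denotes the non-negative integers. For integers $0\le m<n$, $S_{n,m}$ is the group of permutations of $\{m,m+1,\dots,n-1\}$. For a real family $(a_{m,n})_{0\le m<n}$, $\limsup_{n-m\to+\infty}a_{m,n}=\lim_{N\to\infty}\sup\{a_{m,n}: n-m\ge N\}$, $\liminf_{n-m\to+\infty}a_{m,n}=\lim_{N\to\infty}\inf\{a_{m,n}: n-m\ge N\}$, and $\lim_{n-m\to+\infty}a_{m,n}$ exists if these agree (and are finite). Define $$\overline{BF}(x,y)=\limsup_{n-m\to+\infty}\ \inf_{\sigma\in S_{n,m}}\frac1{n-m}\sum_{k=m}^{n-1}d(T^kx,T^{\sigma(k)}y),\qquad \underline{BF}(x,y)=\liminf_{n-m\to+\infty}\ \inf_{\sigma\in S_{n,m}}\frac1{n-m}\sum_{k=m}^{n-1}d(T^kx,T^{\sigma(k)}y).$$ $BF(x,y)$ is said to exist if $\overline{BF}(x,y)=\underline{BF}(x,y)$, and then $BF(x,y)$ denotes the common value. A point $x\in X$ is uniformly generic if for every continuous $f:X\to\mathbb{R}$ the limit $\lim_{n-m\to+\infty}\frac1{n-m}\sum_{k=m}^{n-1}f(T^kx)$ exists. *)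

(* Defs.v *)
From mathcomp Require Import all_boot all_order all_algebra all_fingroup.
From mathcomp Require Import all_classical all_reals all_analysis.

Set Implicit Arguments.
Unset Strict Implicit.
Unset Printing Implicit Defensive.

Import Order.TTheory GRing.Theory Num.Theory.
Import numFieldNormedType.Exports.

Local Open Scope classical_set_scope.
Local Open Scope ring_scope.

Definition gap (N : nat) : set (nat * nat) :=
  [set p | (p.1 < p.2)%N /\ (N <= p.2 - p.1)%N].

(* The sups and infs are extended reals, so that no boundedness of the family
   is presupposed; both sequences are monotone in [N], hence converge. *)
Definition limsup_gap (R : realType) (a : nat -> nat -> R) : \bar R :=
  limn (fun N => ereal_sup [set (a p.1 p.2)%:E | p in gap N]).

Definition liminf_gap (R : realType) (a : nat -> nat -> R) : \bar R :=
  limn (fun N => ereal_inf [set (a p.1 p.2)%:E | p in gap N]).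

Definition lim_gap_exists (R : realType) (a : nat -> nat -> R) : Prop :=
  limsup_gap a = liminf_gap a /\ limsup_gap a \is a fin_num.

(* Permutations of {m, ..., n - 1}, seen as the permutations of {0, ..., n - 1}
   that fix every i < m. *)
Definition perm_itv (m n : nat) : {set {perm 'I_n}} :=
  Sym [set i : 'I_n | (m <= i)%N]%SET.

Definition matching_cost (R : realType) (X : metricType R) (T : X -> X)
    (x y : X) (m n : nat) (s : {perm 'I_n}) : R :=
  ((n - m)%N%:R)^-1 *
  \sum_(k < n | (m <= k)%N) mdist (iter k T x) (iter (s k) T y).

Definition min_matching_cost (R : realType) (X : metricType R) (T : X -> X)
    (x y : X) (m n : nat) : R :=
  inf [set matching_cost T x y m s | s in [set s | s \in perm_itv m n]].

Definition BF_sup (R : realType) (X : metricType R) (T : X -> X) (x y : X) :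
  \bar R := limsup_gap (min_matching_cost T x y).

Definition BF_inf (R : realType) (X : metricType R) (T : X -> X) (x y : X) :
  \bar R := liminf_gap (min_matching_cost T x y).

Definition BF_exists (R : realType) (X : metricType R) (T : X -> X)
    (x y : X) : Prop :=
  BF_sup T x y = BF_inf T x y.

Definition birkhoff_average (R : realType) (X : metricType R) (T : X -> X)
    (f : X -> R) (x : X) (m n : nat) : R :=
  ((n - m)%N%:R)^-1 * \sum_(m <= k < n) f (iter k T x).

Definition uniformly_generic (R : realType) (X : metricType R) (T : X -> X)
    (x : X) : Prop :=
  forall f : X -> R, continuous f -> lim_gap_exists (birkhoff_average T f x).

(* Main.v *)
(* Two windows of the same large length carry nearly the same Birkhoff sums for
   finitely many bump functions subordinate to a finite net. By the deficiency
   form of Hall's theorem, all but few points of one window of the orbit of x can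
   then be paired with nearby points of the other, and likewise for y. Hence the
   optimal cost of any long window [q] bounds, up to a small error, the cost of
   every window of the same length. Costs of consecutive windows add up, so the
   bound passes to all much longer windows, and the limsup is at most the cost of
   [q]. *)
From HB Require Import structures.
Require Import Defs.
From mathcomp Require Import all_boot all_order all_algebra all_fingroup.
From mathcomp Require Import all_classical all_reals all_analysis.
From mathcomp Require Import lra.

Set Implicit Arguments.
Unset Strict Implicit.

Import Order.TTheory GRing.Theory Num.Theory.
Import numFieldNormedType.Exports.

(** * Deficiency form of Hall's theorem *)

Definition good_indices (I : finType) (E : rel I) (s : {perm I}) : {set I} :=
  [set k | E k (s k)].

(* The last disjunct is the case of a path that closes up into a cycle; it is
   the form preserved when the induction swaps the first two images of [s]. *)
Lemma no_augmenting_path (I : finType) (E : rel I) (s : {perm I}) (k0 : I)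
    (p : seq I) :
  (forall t : {perm I}, #|good_indices E t| <= #|good_indices E s|) ->
  k0 \notin good_indices E s ->
  path (fun k l => E k (s l)) k0 p -> uniq (k0 :: p) ->
  (last k0 p \notin good_indices E s) && (last k0 p != k0)
    || E (last k0 p) (s k0) -> False.
Proof.
elim: p s k0 => [|k1 p IHp] s k0 smax k0bad /=.
  by move=> _ _; rewrite eqxx andbF /=; rewrite inE in k0bad; apply/negP.
rewrite inE negb_or => /andP[E01 pathp] /and3P[/andP[k01 k0p] k1p uniqp] lastP.
(* [s'] exchanges the images of [k0] and [k1]. Now [k0] is good and only [k1] can have turned bad,
   so [s'] is again maximal. *)
pose s' : {perm I} := (tperm k0 k1 * s)%g.
have s'0 : s' k0 = s k1 by rewrite permM tpermL.
have s'1 : s' k1 = s k0 by rewrite permM tpermR.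
have s'D k : k0 != k -> k1 != k -> s' k = s k.
  by move=> ? ?; rewrite permM tpermD.
have sub : k0 |: (good_indices E s :\ k1) \subset good_indices E s'.
  apply/fintype.subsetP => k; rewrite !inE => /orP[/eqP->|/andP[k1k Ek]].
    by rewrite s'0.
  have [<-|k0k] := eqVneq k0 k; first by rewrite s'0.
  by rewrite s'D // eq_sym.
have k0D : k0 \notin good_indices E s :\ k1.
  by rewrite in_setD1 negb_and k0bad orbT.
have card1 := cardsD1 k1 (good_indices E s).
have k1good : k1 \in good_indices E s.
  apply/negPn/negP => k1bad.
  have := subset_leq_card sub; rewrite cardsU1 k0D.
  rewrite (negPf k1bad) add0n in card1.
  by rewrite -card1 add1n ltnNge smax.
rewrite k1good in card1.
(* If [k1] stayed good, [s'] would beat [s]. The unpaired index has thus moved from [k0] to [k1],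
   where the induction restarts. *)
have k1bad' : k1 \notin good_indices E s'.
  apply/negP => k1good'.
  have : k1 |: (k0 |: (good_indices E s :\ k1)) \subset good_indices E s'.
    by rewrite finset.subUset finset.sub1set k1good'.
  move/subset_leq_card; rewrite cardsU1 cardsU1 k0D !inE eqxx eq_sym (negPf k01).
  by rewrite /= -card1 add1n ltnNge smax.
have s'p k : k \in p -> s' k = s k.
  move=> kp; apply: s'D.
    by move: k0p; apply: contraNneq => ->.
  by move: k1p; apply: contraNneq => ->.
apply: (IHp s' k1) => //=.
- move=> t; apply: leq_trans (smax t) _; apply: leq_trans (subset_leq_card sub).
  by rewrite cardsU1 k0D card1.
- apply/(pathP k1) => i ip; move/(pathP k1): pathp => /(_ i ip).
  by rewrite s'p ?mem_nth.
- by rewrite k1p.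
rewrite s'1; case/orP: lastP => [/andP[lastbad _]|->]; last by rewrite orbT.
have lastk1 : last k1 p != k1 by apply: contraNneq lastbad => ->.
have lastp : last k1 p \in p.
  by have := mem_last k1 p; rewrite inE (negPf lastk1).
by move: lastbad; rewrite lastk1 !inE s'p // => ->.
Qed.

(* [A] is the set of indices reachable from unpaired ones by alternating paths,
   for an [s] with the most good indices. *)
Lemma hall_deficiency (I : finType) (E : rel I) :
  exists (s : {perm I}) (A : {set I}),
    #|[set k | ~~ E k (s k)]| + #|[set l | [exists k in A, E k l]]| <= #|A|.
Proof.
pose s := [arg max_(s > (1%g : {perm I})) #|good_indices E s|].
have smax (t : {perm I}) : #|good_indices E t| <= #|good_indices E s|.
  by rewrite /s; case: arg_maxnP => // s' _; apply.
pose e k l := E k (s l).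
pose bad := [set k | ~~ E k (s k)].
pose A := [set l | [exists k in bad, connect e k l]].
pose A' := [set l | [exists k in A, e k l]].
exists s, A.
have -> : [set l | [exists k in A, E k l]] = s @: A'.
  apply/setP => l; rewrite inE; apply/existsP/imsetP => [[k /andP[kA Ekl]]|].
    exists ((s^-1)%g l); rewrite ?permKV // inE; apply/existsP; exists k.
    by rewrite kA /e permKV.
  by move=> [l' + ->]; rewrite inE => /existsP[k]; exists k.
rewrite card_imset; last exact: perm_inj.
(* An index in both sets would end an alternating path joining two unpaired indices, or closing up
   into a cycle if they coincide. *)
have <- : #|bad :|: A'| = #|bad| + #|A'|.
  apply/eqP; rewrite (leq_card_setU bad A') -finset.setI_eq0; apply/eqP/setP => l.
  rewrite !inE; apply/negP => /andP[lbad /existsP[k /andP[]]].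
  rewrite inE => /existsP[k0 /andP[k0bad conn]] ekl.
  have k0bad' : k0 \notin good_indices E s by move: k0bad; rewrite !inE.
  have [lk0|lk0] := eqVneq l k0.
    case/connectP: conn ekl => p ep ->; rewrite /e lk0.
    case: (shortenP ep) => p' ep' uniqp' _ ekl.
    by apply: (no_augmenting_path smax k0bad' ep' uniqp'); rewrite ekl orbT.
  case/connectP: (connect_trans conn (connect1 ekl)) lbad lk0 => p ep ->.
  case: (shortenP ep) => p' ep' uniqp' _ lbad lk0.
  apply: (no_augmenting_path smax k0bad' ep' uniqp').
  by rewrite lk0 inE lbad.
apply: subset_leq_card; rewrite finset.subUset; apply/andP; split;
  apply/fintype.subsetP => l.
  move=> lbad; rewrite inE; apply/existsP; exists l.
  by rewrite lbad connect0.
rewrite !inE => /existsP[k /andP[]]; rewrite inE.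
move=> /existsP[k0 /andP[k0bad c]] ekl; apply/existsP; exists k0; rewrite k0bad /=.
exact: connect_trans c (connect1 ekl).
Qed.

(** * Matchings between two windows of equal length *)

Local Open Scope classical_set_scope.
Local Open Scope ring_scope.

Definition concat_perm (a b : nat) (s : {perm 'I_a}) (t : {perm 'I_b}) :
    'I_(a + b) -> 'I_(a + b) :=
  fun i => unsplit (match fintype.split i with
                    | inl j => inl (s j) | inr j => inr (t j) end).

Lemma concat_perm_inj (a b : nat) (s : {perm 'I_a}) (t : {perm 'I_b}) :
  injective (concat_perm s t).
Proof.
move=> i j /(can_inj unsplitK) eqij; apply: (can_inj splitK).
by move: eqij; do 2!case: fintype.split => ?; case=> // /perm_inj ->.
Qed.

(** Windows are reindexed from 0 and the cost is not divided by the length, so that bounds add under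
    both composition and concatenation. *)
Definition matchable (R : realType) (X : metricType R) (u v : nat -> X)
    (l : nat) (C : R) : Prop :=
  exists s : {perm 'I_l}, \sum_(k < l) mdist (u k) (v (s k)) <= C.

Section Matchable.
Variables (R : realType) (X : metricType R).
Implicit Types (u v w : nat -> X) (C D : R).

Lemma matchable_le u v l C D : C <= D -> matchable u v l C -> matchable u v l D.
Proof. by move=> CD [s sC]; exists s; apply: le_trans CD. Qed.

Lemma matchable_trans u v w l C D :
  matchable u v l C -> matchable v w l D -> matchable u w l (C + D).
Proof.
move=> [s sC] [t tD]; exists (s * t)%g.
apply: le_trans (lerD sC tD).
rewrite [X in _ <= _ + X](reindex_inj (@perm_inj _ s)) -big_split /=.
by apply: ler_sum => k _; rewrite permM metric_triangle.
Qed.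

Lemma matchable_concat u v a b C D :
  matchable u v a C ->
  matchable (fun k => u (a + k)%N) (fun k => v (a + k)%N) b D ->
  matchable u v (a + b) (C + D).
Proof.
move=> [s sC] [t tD]; exists (perm (@concat_perm_inj a b s t)).
rewrite big_split_ord /=; apply: le_trans (lerD sC tD).
rewrite lerD // ler_sum // => k _; rewrite permE /concat_perm.
  by rewrite (unsplitK (inl _)).
by rewrite (unsplitK (inr _)).
Qed.

Lemma matchable_diam u v l D :
  (forall z z' : X, mdist z z' <= D) -> matchable u v l (l%:R * D).
Proof.
move=> diamD; exists 1%g.
rewrite -[X in X%:R * _]card_ord -sumr_const mulr_suml.
by apply: ler_sum => k _; rewrite mul1r.
Qed.

(** A permutation of [l] indices is shifted by [m] and extended by the identity below [m]. *)
Lemma le_min_matching_cost (T : X -> X) (x y : X) m l C : (0 < l)%N ->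
  matchable (fun k => iter (m + k) T x) (fun k => iter (m + k) T y) l C ->
  min_matching_cost T x y m (m + l) <= C / l%:R.
Proof.
move=> l0 [s sC].
have lb : has_lbound [set matching_cost T x y m s
    | s in [set s : {perm 'I_(m + l)} | s \in perm_itv m (m + l)]].
  exists 0 => _ [t _ <-]; rewrite mulr_ge0 ?invr_ge0 ?ler0n ?sumr_ge0 // => k _.
  exact: mdist_ge0.
have sitv : perm (@concat_perm_inj m l 1%g s) \in perm_itv m (m + l).
  rewrite inE; apply/fintype.subsetP => k; rewrite !inE permE /concat_perm.
  case: (fintype.split_ordP k) => j -> /=; last by rewrite leq_addr.
  by rewrite perm1 eqxx.
have /le_trans := ge_inf lb
  (imageP (fun s => matching_cost T x y m s) (sitv : [set s | s \in _] _)).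
apply.
rewrite /matching_cost mulrC addKn ler_wpM2r ?invr_ge0 ?ler0n //.
rewrite big_split_ord /= big1 ?add0r => [|k]; last by rewrite leqNgt ltn_ord.
apply: le_trans sC; rewrite big_mkcond ler_sum //= => k _.
by rewrite leq_addr permE /concat_perm (unsplitK (inr _)).
Qed.

Lemma min_matching_cost_matchable (T : X -> X) (x y : X) m l (e : R) :
  (0 < l)%N -> 0 < e ->
  matchable (fun k => iter (m + k) T x) (fun k => iter (m + k) T y) l
    (l%:R * (min_matching_cost T x y m (m + l) + e)).
Proof.
move=> l0 e0; rewrite /min_matching_cost.
have [|_ [s sitv <-]] := @inf_adherent _ [set matching_cost T x y m s
    | s in [set s : {perm 'I_(m + l)} | s \in perm_itv m (m + l)]] _ e0.
  split.
    exists (matching_cost T x y m (1%g : {perm 'I_(m + l)})), 1%g => //.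
    by rewrite /= inE perm_on1.
  exists 0 => _ [t _ <-]; rewrite mulr_ge0 ?invr_ge0 ?ler0n ?sumr_ge0 // => k _.
  exact: mdist_ge0.
set c := inf _ => /ltW cost_le.
(* [s] preserves the indices from [m] on, so subtracting [m] leaves a permutation of [l] indices. *)
have m_le (j : 'I_l) : (m <= s (rshift m j))%N.
  have := sitv; rewrite /= inE => /(perm_closed (rshift m j)).
  by rewrite !inE /= leq_addr => ->.
have s_ltl (j : 'I_l) : (s (rshift m j) - m < l)%N.
  by rewrite ltn_subLR // ltn_ord.
have s_inj : injective (fun j => Ordinal (s_ltl j)).
  move=> i j [] /(congr1 (addn m)); rewrite !subnKC // => /val_inj /perm_inj.
  exact: rshift_inj.
exists (perm s_inj).
move: cost_le; rewrite /matching_cost addKn mulrC ler_pdivrMr ?ltr0n //.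
rewrite mulrC; apply: le_trans.
rewrite big_split_ord /= [X in _ <= X + _]big1 ?add0r => [|k]; last first.
  by rewrite leqNgt ltn_ord.
rewrite [leRHS]big_mkcond ler_sum //= => k _.
by rewrite leq_addr permE /= subnKC.
Qed.

End Matchable.

(** * Consequences of compactness *)

Lemma continuous_mdist (R : realType) (X : metricType R) (p : X) :
  continuous (mdist p : X -> R).
Proof.
move=> a; apply/cvgrPdist_lt => e e0.
have : \forall b \near a, ball a e b by exact: nbhsx_ballx.
apply: filterS => b; rewrite ballEmdist /= => ab.
have := metric_triangle p a b; have := metric_triangle p b a.
rewrite [mdist b a]metric_sym ltr_norml => ? ?; apply/andP; split; lra.
Qed.

Lemma compact_bounded_mdist (R : realType) (X : metricType R) (x : X) :
  compact [set: X] -> exists2 D : R, 0 < D & forall p q : X, mdist p q <= D.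
Proof.
move=> cX; have [||c _ cmax] := @compact_EVT_max X R (mdist x) setT _ cX.
- by exists x.
- by apply: continuous_subspaceT => ?; apply: continuous_mdist.
have c0 := mdist_ge0 x c.
(* The summand 1 keeps the bound positive even when [X] is a single point. *)
exists (1 + (mdist x c) *+ 2); first by lra.
move=> p q; have := metric_triangle p x q; rewrite [mdist p x]metric_sym.
have := cmax p (in_setT _); have := cmax q (in_setT _); lra.
Qed.

Lemma compact_finite_net (R : realType) (X : metricType R) (x : X) (e : R) :
  compact [set: X] -> 0 < e ->
  exists z : seq X, forall p, exists2 q, q \in z & mdist q p < e.
Proof.
move=> cX e0.
pose Xp : ptopologicalType :=
  HB.pack (X : Type) (X : topologicalType) (isPointed.Build X x).
have : compact [set: Xp] by exact: cX.
rewrite compact_cover => /(_ X setT (fun q => [set p | mdist q p < e])).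
case.
- move=> q _; rewrite -[X in open X]/((mdist q : X -> R) @^-1` [set r | r < e]).
  by apply: open_comp; [move=> ? _; apply: continuous_mdist|exact: open_lt].
- by move=> p _; exists p => //=; rewrite mdistxx.
- move=> z _ zcov; exists (finmap.enum_fset z) => p; have [//|q qz qp] := zcov p.
  by exists q.
Qed.

(** * Limits along long windows *)

Lemma limsup_gapE (R : realType) (a : nat -> nat -> R) :
  limsup_gap a =
  ereal_inf (range (fun N => ereal_sup [set (a p.1 p.2)%:E | p in gap N])).
Proof.
apply/cvg_lim => //; apply: ereal_nonincreasing_cvgn => N M NM.
apply: ge_ereal_sup => _ [p [pp Mp] <-]; apply: ereal_sup_ubound.
by exists p => //; split=> //; apply: leq_trans Mp.
Qed.

Lemma liminf_gapE (R : realType) (a : nat -> nat -> R) :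
  liminf_gap a =
  ereal_sup (range (fun N => ereal_inf [set (a p.1 p.2)%:E | p in gap N])).
Proof.
apply/cvg_lim => //; apply: ereal_nondecreasing_cvgn => N M NM.
apply: le_ereal_inf_tmp => _ [p [pp Mp] <-]; apply: ereal_inf_lbound.
by exists p => //; split=> //; apply: leq_trans Mp.
Qed.

(** On long windows all values lie within [e / 2] of the common finite limit, above and below. *)
Lemma lim_gap_exists_cauchy (R : realType) (a : nat -> nat -> R) (e : R) :
  lim_gap_exists a -> 0 < e ->
  exists N, forall p q, gap N p -> gap N q -> a p.1 p.2 < a q.1 q.2 + e.
Proof.
move=> [eq_lim /fineK lim_fin] e0.
set L := fine _ in lim_fin.
have : (limsup_gap a < (L + e / 2)%:E)%E by rewrite -lim_fin lte_fin; lra.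
rewrite limsup_gapE => /ereal_inf_lt[_ [N _ <-] ltN].
have : ((L - e / 2)%:E < liminf_gap a)%E by rewrite -eq_lim -lim_fin lte_fin; lra.
rewrite liminf_gapE => /ereal_sup_gt[_ [M _ <-] gtM].
exists (maxn N M) => p q [pp]; rewrite geq_max => /andP[Np _].
move=> [qq]; rewrite geq_max => /andP[_ Mq].
have : (a p.1 p.2 < L + e / 2)%R.
  rewrite -lte_fin; apply: le_lt_trans ltN; apply: ereal_sup_ubound.
  by exists p.
have : (L - e / 2 < a q.1 q.2)%R.
  rewrite -lte_fin; apply: lt_le_trans gtM _; apply: ereal_inf_lbound.
  by exists q.
by lra.
Qed.

(** * Two windows of one generic orbit *)

Lemma uniformly_generic_sum_close (R : realType) (X : metricType R)
    (T : X -> X) (x : X) (f : X -> R) (e : R) :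
  uniformly_generic T x -> continuous f -> 0 < e ->
  exists N, forall m m' l, (N <= l)%N ->
    \sum_(k < l) f (iter (m + k) T x)
      <= \sum_(k < l) f (iter (m' + k) T x) + l%:R * e.
Proof.
move=> gx cf e0; have [N closeN] := lim_gap_exists_cauchy (gx f cf) e0.
(* Length 0 is treated apart, since [gap] contains only nonempty windows. *)
exists N => m m' [_|l Nl]; first by rewrite !big_ord0 mul0r addr0.
have gapN j : gap N (j, j + l.+1)%N.
  by split; rewrite /= ?addKn // -[X in (X < _)%N]addn0 ltn_add2l.
have sumE j : \sum_(k < l.+1) f (iter (j + k) T x) =
    l.+1%:R * birkhoff_average T f x j (j + l.+1).
  rewrite /birkhoff_average addKn mulrA divff ?mul1r ?pnatr_eq0 //.
  rewrite -[X in \sum_(X <= _ < _) _]add0n big_addn addKn big_mkord.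
  by apply: eq_bigr => k _; rewrite addnC.
rewrite !sumE -mulrDr ler_wpM2l //.
exact: ltW (closeN (m, m + l.+1) (m', m' + l.+1) _ _).
Qed.

(** Hall's set [A] cannot have far fewer neighbours than elements: a function equal to 1 on the
    points of [A] and to 0 off its neighbours has nearly equal sums over both windows. *)
Lemma uniformly_generic_matchable (R : realType) (X : metricType R)
    (T : X -> X) (x : X) (e : R) :
  compact [set: X] -> uniformly_generic T x -> 0 < e ->
  exists N, forall m m' l, (N <= l)%N ->
    matchable (fun k => iter (m + k) T x) (fun k => iter (m' + k) T x) l
      (l%:R * e).
Proof.
move=> cX gx e0.
have [D D0 diamD] := compact_bounded_mdist x cX.
(* Good pairs cost less than [3 * h], which is [e / 2]; at most [l * d] bad pairs, each costing at
   most [D], add [l * e / 2]. *)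
pose h : R := e / 6; have h0 : 0 < h by rewrite /h; lra.
pose d : R := e / (2 * D); have d0 : 0 < d by rewrite divr_gt0 // mulr_gt0.
have [z net] := compact_finite_net x cX h0.
pose center := tnth (in_tuple z).
(* The bump is at least 1 within [h] of its center and 0 beyond [2 * h]. *)
pose bump i p := Num.max 0 (2 - mdist (center i) p / h).
pose f (S : {set 'I_(size z)}) p := Num.min 1 (\sum_(i in S) bump i p).
have bump_ge0 i p : 0 <= bump i p by rewrite /bump le_max lexx.
have f_cont S : continuous (f S).
  move=> p; apply: continuous_min; first exact: cvg_cst.
  apply: continuous_big => [|i _] q; first exact: add_continuous.
  apply: (@continuous_max R X (fun=> 0) (fun p => 2 - mdist (center i) p / h) q).
    exact: cvg_cst.
  apply: cvgB; first exact: cvg_cst.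
  by apply: cvgM; [exact: continuous_mdist|exact: cvg_cst].
(* There are finitely many [S], so one length serves for all of them, before the windows and [A] are
   known. *)
have /choice[N closeN] := fun S => uniformly_generic_sum_close gx (f_cont S) d0.
exists (\max_S N S) => m m' l Nl.
set u := fun k => iter (m + k) T x; set v := fun k => iter (m' + k) T x.
pose E (k k' : 'I_l) := mdist (u k) (v k') < 3 * h.
have [s [A]] := hall_deficiency E.
set bad := [set k | _]%SET; set NA := [set k | _]%SET => cardA.
pose S := [set i | [exists k in A, mdist (center i) (u k) < h]]%SET.
have f_le1 p : f S p <= 1 by rewrite /f ge_min lexx.
have f_ge0 p : 0 <= f S p by rewrite /f le_min ler01 sumr_ge0.
have fA k : k \in A -> f S (u k) = 1.
  move=> kA; apply/eqP; rewrite eq_le f_le1 /f le_min lexx /=.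
  have [_ /(tnthP (in_tuple z))[i ->] ik] := net (u k).
  have iS : i \in S by rewrite inE; apply/existsP; exists k; rewrite kA.
  rewrite (bigD1 i) //= ler_wpDr ?sumr_ge0 // /bump le_max.
  have : mdist (center i) (u k) / h < 1 by rewrite ltr_pdivrMr ?mul1r.
  move=> ?; apply/orP; right; lra.
have fNA k : k \notin NA -> f S (v k) = 0.
  move=> kNA; rewrite /f big1 ?min_r ?ler01 // => i.
  rewrite inE => /existsP[j /andP[jA ij]]; rewrite /bump max_l //.
  suff : 2 <= mdist (center i) (v k) / h by move=> ?; lra.
  (* Otherwise [u j] lies within [h] and [v k] within [2 * h] of the same center, so [E j k] holds
     and [k] is in [NA]. *)
  rewrite ler_pdivlMr // leNgt; apply/negP => ik; move/negP: kNA; apply.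
  rewrite inE; apply/existsP; exists j; rewrite jA /E /=.
  have := metric_triangle (u j) (center i) (v k).
  by rewrite [mdist (u j) (center i)]metric_sym; lra.
have cardAr : #|A|%:R <= #|NA|%:R + l%:R * d.
  apply: (@le_trans _ _ (\sum_(k < l) f S (u k))).
    rewrite -sumr_const [leLHS]big_mkcond ler_sum //= => k _.
    by case: ifPn => // /fA->.
  apply: le_trans (closeN S m m' l _) _.
    by apply: leq_trans Nl; apply: leq_bigmax.
  rewrite lerD2r -sumr_const [leRHS]big_mkcond ler_sum //= => k _.
  by case: ifPn => // /fNA->.
have cardbad : #|bad|%:R <= l%:R * d.
  by move: cardA; rewrite -(ler_nat R) natrD; lra.
exists s; apply: (@le_trans _ _ (\sum_(k < l) (3 * h + (k \in bad)%:R * D))).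
  apply: ler_sum => k _; rewrite inE /E.
  case: ltP => [/ltW|_]; first by rewrite mul0r addr0.
  by have := diamD (u k) (v (s k)); rewrite /= mul1r; lra.
have -> : \sum_(k < l) (3 * h + (k \in bad)%:R * D) =
    l%:R * (e / 2) + #|bad|%:R * D.
  rewrite big_split /= sumr_const card_ord -mulr_suml -[3 * h *+ l]mulr_natl.
  rewrite -[in RHS]sumr_const [in RHS]big_mkcond /=; congr (_ + _ * _).
    by congr (_ * _); rewrite /h; lra.
  by apply: eq_bigr => k _; case: (k \in bad).
have := ler_wpM2r (ltW D0) cardbad.
have -> : l%:R * d * D = l%:R * (e / 2).
  by rewrite /d invfM -!mulrA mulVf ?mulr1 // gt_eqF.
lra.
Qed.

(** * Bounding all much longer windows by one window *)

Lemma matchable_blocks (R : realType) (X : metricType R) (u v : nat -> X) l C :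
  (forall j, matchable (fun k => u (j + k)%N) (fun k => v (j + k)%N) l C) ->
  forall q j,
    matchable (fun k => u (j + k)%N) (fun k => v (j + k)%N) (q * l)
      (q%:R * C).
Proof.
move=> uv; elim=> [|q IHq] j.
  by exists 1%g; rewrite mul0n big_ord0 mul0r.
rewrite mulSn mulrSr mulrDl mul1r addrC; apply: matchable_concat => //.
under eq_fun do rewrite addnA.
by under [X in matchable _ X]eq_fun do rewrite addnA.
Qed.

(** A longer window is cut into blocks of the length of [q]. [N'] depends on [q] because the
    incomplete last block must be negligible. *)
Lemma min_matching_cost_le_gap (R : realType) (X : metricType R) (T : X -> X)
    (x y : X) (e : R) :
  compact [set: X] -> uniformly_generic T x -> uniformly_generic T y -> 0 < e ->
  exists N, forall q, gap N q -> exists N', forall p, gap N' p ->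
    min_matching_cost T x y p.1 p.2 <= min_matching_cost T x y q.1 q.2 + e.
Proof.
move=> cX gx gy e0.
pose h : R := e / 4; have h0 : 0 < h by rewrite /h; lra.
have [D D0 diamD] := compact_bounded_mdist x cX.
have [Nx matchx] := uniformly_generic_matchable cX gx h0.
have [Ny matchy] := uniformly_generic_matchable cX gy h0.
exists (maxn Nx Ny) => -[m n] [/= lt_mn].
rewrite -(subnKC (ltnW lt_mn)); set l := (n - m)%N; rewrite addKn geq_max.
have l0 : (0 < l)%N by rewrite subn_gt0.
move=> /andP[Nxl Nyl]; set c := min_matching_cost _ _ _ _ _.
have matchl j : matchable (fun k => iter (j + k) T x) (fun k => iter (j + k) T y)
    l (l%:R * (c + 3 * h)).
  (* The three [h] pay for moving along the orbit of [x], for approaching the infimum, and for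
     moving back along the orbit of [y]. *)
  have xy := matchable_trans (matchx j m l Nxl)
    (min_matching_cost_matchable T x y m l0 h0).
  apply: matchable_le (matchable_trans xy (matchy m j l Nyl)).
  by rewrite -/c -!mulrDr ler_wpM2l //; lra.
(* This sign allows the total length of the full blocks to be rounded up to [L] below. *)
have c_ge : 0 <= c + 3 * h.
  have [s] := matchl 0%N; rewrite -(pmulr_rge0 _ (_ : 0 < l%:R)) ?ltr0n //.
  by apply: le_trans; apply: sumr_ge0 => k _; apply: mdist_ge0.
(* Beyond this length the remainder, costing at most [l * D], adds at most [h] per unit of length:
   the fourth quarter of [e]. *)
exists (Num.bound (l%:R * D / h)) => -[m' n'] [/= lt_mn'].
rewrite -(subnKC (ltnW lt_mn')); set L := (n' - m')%N; rewrite addKn => ltL.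
have L0 : (0 < L)%N by rewrite subn_gt0.
have {ltL} lD_le : l%:R * D <= h * L%:R.
  rewrite [leRHS]mulrC -ler_pdivrMr //.
  have /archi_boundP/ltW/le_trans : 0 <= l%:R * D / h.
    by rewrite divr_ge0 ?mulr_ge0 // ltW.
  by apply; rewrite ler_nat.
have matchL : matchable (fun k => iter (m' + k) T x) (fun k => iter (m' + k) T y)
    L ((L %/ l)%N%:R * (l%:R * (c + 3 * h)) + (L %% l)%N%:R * D).
  rewrite [L in matchable _ _ L](divn_eq L l); apply: matchable_concat.
    by apply: (@matchable_blocks _ _ (fun k => iter k T x) (fun k => iter k T y)).
  exact: matchable_diam.
apply: le_trans (le_min_matching_cost L0 matchL) _.
rewrite ler_pdivrMr ?ltr0n // mulrA -natrM.
have : (L %/ l * l)%N%:R * (c + 3 * h) <= L%:R * (c + 3 * h).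
  by rewrite ler_wpM2r // ler_nat leq_trunc_div.
have : (L %% l)%N%:R * D <= l%:R * D.
  by rewrite ler_wpM2r ?(ltW D0) // ler_nat ltnW // ltn_mod.
by rewrite /h in lD_le *; lra.
Qed.

Theorem theorem4p2 (R : realType) (X : metricType R) (T : X -> X)
    (compact_X : compact [set: X]) (continuous_T : continuous T) (x y : X)
    (generic_x : uniformly_generic T x) (generic_y : uniformly_generic T y) :
  BF_exists T x y.
Proof.
apply/eqP; rewrite /BF_sup /BF_inf eq_le; apply/andP; split; last first.
  rewrite limsup_gapE liminf_gapE; apply: le_ereal_inf_tmp => _ [N _ <-].
  apply: ge_ereal_sup => _ [M _ <-].
  (* One window long enough for both [N] and [M] lies between the infimum and the supremum. *)
  pose p := (0%N, (maxn N M).+1).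
  have gapp K : (K <= maxn N M)%N -> gap K p by move=> ?; split; rewrite //= leqW.
  apply: (@le_trans _ _ (min_matching_cost T x y p.1 p.2)%:E).
    by apply: ereal_inf_lbound; exists p => //; apply: gapp; rewrite leq_maxr.
  by apply: ereal_sup_ubound; exists p => //; apply: gapp; rewrite leq_maxl.
apply/lee_addgt0Pr => e e0.
have [N leN] := min_matching_cost_le_gap compact_X generic_x generic_y e0.
(* With [e] subtracted on the left, it suffices to bound the infimum over [gap N] from below, one
   window [q] at a time. *)
rewrite -leeBlDr //.
rewrite liminf_gapE; apply: le_trans (ereal_sup_ubound _); last by exists N.
apply: le_ereal_inf_tmp => _ [q gapq <-]; rewrite leeBlDr //.
have [N' leN'] := leN q gapq.
rewrite limsup_gapE; apply: le_trans (ereal_inf_lbound _) _; first by exists N'.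
apply: ge_ereal_sup => _ [p gapp <-]; rewrite -EFinD lee_fin.
exact: leN'.
Qed.
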